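(* Let $G=(\mathcal H,\mathcal V)$ be a two-dimensional graph on a finite vertex set, with adjacency matrices $H$ and $V$, and let $X_G$ be the two-dimensional shift space generated by $G$. Suppose that for all vertices $i,j$ one has $(HV)_{ij}\neq 0 \Leftrightarrow (VH)_{ij}\neq 0$. If $H$ (or $V$) is irreducible, then $X_G$ is transitive.
   Context: A two-dimensional graph $G=(\mathcal H,\mathcal V)$ is a pair of finite directed graphs (loops allowed, no multiple edges) on a common vertex set $A$, with $0$-$1$ adjacency matrices $H$ (for $\mathcal H$) and $V$ (for $\mathcal V$). It generates $X_G=\{x\in A^{\mathbb Z^2}: H_{x(m,n)\,x(m+1,n)}=1 \text{ and } V_{x(m,n)\,x(m,n+1)}=1 \text{ for all } (m,n)\in\mathbb Z^2\}$, with the subspace topology of the product topology on $A^{\mathbb Z^2}$ ($A$ discrete). Shift spaces (subshifts) are by definition non-empty, closed and shift-invariant. For $a\in\mathbb Z^2$, $(\sigma^a x)(k)=x(k+a)$. $X_G$ is transitive if for any non-empty open sets $U,W\subseteq X_G$ there is $n\in\mathbb Z^2$ with $\sigma^n(U)\cap W\neq\emptyset$. A non-negative square matrix $M$ is irreducible if for every pair of indices $i,j$ there is $k\in\mathbb N=\{1,2,\dots\}$ with $(M^k)_{ij}\neq 0$. *)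

(* Defs.v *)
From mathcomp Require Import all_boot all_order all_algebra.
From mathcomp Require Import all_classical all_reals all_analysis.

Set Implicit Arguments.
Unset Strict Implicit.
Unset Printing Implicit Defensive.

Import GRing.Theory.
Local Open Scope classical_set_scope.
Local Open Scope ring_scope.

(* A relation on a finite type is a directed graph with loops allowed and no
   multiple edges. *)
Record graph2d (A : finType) := Graph2d { hedge : rel A; vedge : rel A }.

(* Rows and columns are indexed by the ranks of the vertices in [enum A]. *)
Definition adjmx (A : finType) (e : rel A) : 'M[nat]_#|A| :=
  \matrix_(i, j) nat_of_bool (e (enum_val i) (enum_val j)).

Definition hadj (A : finType) (G : graph2d A) := adjmx (hedge G).
Definition vadj (A : finType) (G : graph2d A) := adjmx (vedge G).

(* Non-negativity is built into the coefficient semiring [nat]. *)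
Definition irreducible_mx n (M : 'M[nat]_n) : Prop :=
  forall i j : 'I_n, exists2 k : nat, (0 < k)%N & (M ^+ k) i j != 0%N.

Notation config A := {ptws (int * int)%type -> discrete_topology A}.

Definition shift2d (A : finType) (a : int * int) (x : config A) : config A :=
  fun k => x (k + a).

Definition shift_space (A : finType) (X : set (config A)) : Prop :=
  [/\ X !=set0, closed X & forall a : int * int, shift2d a @` X = X].

(* The topology of [subspace X] isolates the points outside [X], so its open
   sets that are contained in [X] are exactly the relatively open subsets
   of [X]. *)
Definition transitive_shift (A : finType) (X : set (config A)) : Prop :=
  forall U W : set (subspace X), U `<=` X -> W `<=` X ->
    open U -> open W -> U !=set0 -> W !=set0 ->
    exists n : int * int, (shift2d n @` U) `&` W !=set0.

Definition graph_shift (A : finType) (G : graph2d A) : set (config A) :=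
  [set x | forall m n : int,
    hadj G (enum_rank (x (m, n))) (enum_rank (x (m + 1, n))) = 1%N /\
    vadj G (enum_rank (x (m, n))) (enum_rank (x (m, n + 1))) = 1%N].

(* Main.v *)
Require Import Defs.
From mathcomp Require Import all_boot all_order all_algebra.
From mathcomp Require Import all_classical all_reals all_analysis.
From mathcomp Require Import zify.

Import Order.TTheory GRing.Theory Num.Theory.
Local Open Scope classical_set_scope.
Local Open Scope ring_scope.

(** The condition on [H V] and [V H] says that an [H]-step followed by a
    [V]-step can be exchanged for a [V]-step followed by an [H]-step with the
    same endpoints, and conversely.  On a unit square this means that a missing
    upper left or lower right corner can always be filled in from the three
    other corners; doing so one cell after the other fills a whole quadrant of
    either kind from its two boundary half-lines ([quadrant_completion]).

    Let [H] be irreducible and let [x], [y] be points of the shift.  Keep the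
    lower left quadrant of [x], place the upper right quadrant of [y] some
    distance [k] to the right, and join the two corners by a horizontal path of
    length [k], which exists by irreducibility.  What is left of the plane is an
    upper left and a lower right quadrant (overlapping along the joining path)
    whose boundaries are now known, so both can be completed
    ([glue_quadrants]).  Moving the corners of the two quadrants far away first,
    one sees any prescribed finite window of [x] and a translate of any
    prescribed window of [y] in a single point ([glue_windows]).  As every
    neighbourhood of a configuration contains a cylinder over a finite window
    ([nbhs_window]), this is transitivity.  If [V] is irreducible instead, one
    exchanges the two coordinates, which preserves the hypothesis. *)

(** * Completing a quadrant *)

Section Quadrant.
Variables (T : Type) (e f : T -> T -> Prop).

(** In a triple passed to [g], the components are the known corner [a], its
    [e]-successor and its [f]-successor; [g] is to return the fourth corner. *)
Fixpoint complete_row (g : T * T * T -> T) (r : nat -> T) (t : T) (i : nat) : T :=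
  if i is i'.+1 then g (r i', r i, complete_row g r t i') else t.

Fixpoint complete (g : T * T * T -> T) (b c : nat -> T) (j : nat) : nat -> T :=
  if j is j'.+1 then complete_row g (complete g b c j') (c j) else b.

(** The diamond property fills the fourth corner of a square next to a known
    corner [a]; a quadrant is filled row by row, each row away from the side.
    The relations [e] and [f] point away from the corner of the quadrant, so
    that both kinds of quadrants are instances. *)
Lemma quadrant_completion (b c : nat -> T) :
  (forall a b c, e a b -> f a c -> exists d, f b d /\ e c d) ->
  b 0%N = c 0%N -> (forall i, e (b i) (b i.+1)) ->
  (forall j, f (c j) (c j.+1)) ->
  exists q : nat -> nat -> T,
    [/\ forall i, q i 0%N = b i, forall j, q 0%N j = c j,
        forall i j, e (q i j) (q i.+1 j) & forall i j, f (q i j) (q i j.+1)].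
Proof.
move=> diamond bc0 eb fc.
have step t : exists d,
    e t.1.1 t.1.2 -> f t.1.1 t.2 -> f t.1.2 d /\ e t.2 d.
  have [[et ft]|nef] := pselect (e t.1.1 t.1.2 /\ f t.1.1 t.2).
    by have [d ?] := diamond _ _ _ et ft; exists d.
  by exists t.2 => et ft; case: nef.
have [g gP] := boolp.choice step.
have row0 j : complete g b c j 0%N = c j by case: j.
have rowS j : (forall i, e (complete g b c j i) (complete g b c j i.+1)) ->
    forall i, f (complete g b c j i) (complete g b c j.+1 i).
  move=> er; elim=> [|i IH]; first by rewrite !row0.
  exact: (gP (_, _, _) (er i) IH).1.
have rowe j : forall i, e (complete g b c j i) (complete g b c j i.+1).
  elim: j => [//|j IH] i.
  exact: (gP (_, _, _) (IH i) (rowS _ IH i)).2.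
by exists (fun i j => complete g b c j i); split=> // i j; exact: rowS.
Qed.

End Quadrant.

(** * Gluing two configurations *)

Section Gluing.
Variables (T : Type) (h v : T -> T -> Prop).

Definition admissible (h v : T -> T -> Prop) (z : int -> int -> T) : Prop :=
  (forall m n, h (z m n) (z (m + 1) n)) /\ (forall m n, v (z m n) (z m (n + 1))).

Definition walk (k : nat) (p : nat -> T) : Prop :=
  forall i, (i < k)%N -> h (p i) (p i.+1).

Hypothesis hv_vh : forall a d,
  (exists2 b, h a b & v b d) <-> (exists2 c, v a c & h c d).

Lemma glue_row (x y : int -> T) (k : nat) (p : nat -> T) :
  (forall m, h (x m) (x (m + 1))) -> (forall m, h (y m) (y (m + 1))) ->
  walk k p -> p 0%N = x 0 -> p k = y 0 ->
  exists w : int -> T, [/\ forall m, h (w m) (w (m + 1)),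
    forall m, m <= 0 -> w m = x m & forall m, k%:Z <= m -> w m = y (m - k%:Z)].
Proof.
move=> hx hy hp p0 pk.
pose w (m : int) := if m <= 0 then x m else
  if m <= k%:Z then p `|m|%N else y (m - k%:Z).
have wx (m : int) : m <= 0 -> w m = x m by rewrite /w => ->.
have wp (m : int) : 0 <= m -> m <= k%:Z -> w m = p `|m|%N.
  rewrite /w => m0 ->; case: ifP => // m0'.
  by have -> : m = 0 by lia.
have wy (m : int) : k%:Z <= m -> w m = y (m - k%:Z).
  move=> km; have [mk|mk] := leP m k%:Z.
    have -> : m = k%:Z by lia.
    by rewrite wp ?subrr //; lia.
  by rewrite /w ifF ?ifF //; lia.
exists w; split=> // m.
have [m0|m0] := ltP m 0; first by rewrite !wx //; lia.
have [mk|mk] := ltP m k%:Z.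
  rewrite !wp; try lia.
  have -> : `|(m + 1)%R|%N = `|m|%N.+1 by lia.
  by apply: hp; lia.
rewrite !wy; try lia.
by have -> : m + 1 - k%:Z = m - k%:Z + 1 by lia.
Qed.

(** The upper left quadrant with corner [(k, 0)] is bounded by the row [w]
    made of [x], the path and [y], and by a column of [y]; the lower right one
    with corner [(0, 0)] by the same row and by a column of [x].  Each half of
    [hv_vh] is the diamond property of one of them. *)
Lemma glue_quadrants (x y : int -> int -> T) (k : nat) (p : nat -> T) :
  admissible h v x -> admissible h v y ->
  walk k p -> p 0%N = x 0 0 -> p k = y 0 0 ->
  exists2 z : int -> int -> T, admissible h v z &
    (forall m n, m <= 0 -> n <= 0 -> z m n = x m n) /\
    (forall m n, 0 <= m -> 0 <= n -> z (m + k%:Z) n = y m n).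
Proof.
move=> [hx vx] [hy vy] hp p0 pk.
have [w [hw wx wy]] := @glue_row (x^~ 0) (y^~ 0) k p (hx^~ 0) (hy^~ 0) hp p0 pk.
have [q [q0 qy qh qv]] : exists q : nat -> nat -> T,
    [/\ forall i, q i 0%N = w (k%:Z - i%:Z), forall j, q 0%N j = y 0 j%:Z,
        forall i j, h (q i.+1 j) (q i j) & forall i j, v (q i j) (q i j.+1)].
  apply: (@quadrant_completion _ (fun a b => h b a) v
    (fun i : nat => w (k%:Z - i%:Z)) (fun j : nat => y 0 j%:Z)).
  - move=> a b c hba vac.
    have [d ? ?] : exists2 d, v b d & h d c by apply/hv_vh; exists a.
    by exists d.
  - by rewrite subr0 wy ?subrr.
  - move=> i.
    have -> : k%:Z - i%:Z = k%:Z - i.+1%:Z + 1 by lia.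
    exact: hw.
  - move=> j; have -> : j.+1%:Z = j%:Z + 1 by lia.
    exact: vy.
have [r [r0 rx rh rv]] : exists r : nat -> nat -> T,
    [/\ forall i, r i 0%N = w i%:Z, forall j, r 0%N j = x 0 (- j%:Z),
        forall i j, h (r i j) (r i.+1 j) & forall i j, v (r i j.+1) (r i j)].
  apply: (@quadrant_completion _ h (fun a b => v b a)
    (fun i : nat => w i%:Z) (fun j : nat => x 0 (- j%:Z))).
  - move=> a b c hab vca.
    have [d ? ?] : exists2 d, h c d & v d b by apply/hv_vh; exists a.
    by exists d.
  - by rewrite wx.
  - move=> i; have -> : i.+1%:Z = i%:Z + 1 by lia.
    exact: hw.
  - move=> j; have -> : - j%:Z = - j.+1%:Z + 1 by lia.
    exact: vx.
pose z (m n : int) := if 0 <= n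
  then if k%:Z <= m then y (m - k%:Z) n else q `|(k%:Z - m)%R|%N `|n|%N
  else if m <= 0 then x m n else r `|m|%N `|n|%N.
(* The four pieces agree on the half-lines they share, so [z] has each of the
   four descriptions on a closed quadrant, and every edge of the plane lies
   inside one of these closed quadrants. *)
have zy (m n : int) : 0 <= n -> k%:Z <= m -> z m n = y (m - k%:Z) n.
  by rewrite /z => -> ->.
have zq (m n : int) : 0 <= n -> m <= k%:Z -> z m n = q `|(k%:Z - m)%R|%N `|n|%N.
  rewrite /z => n0 mk; rewrite n0; case: ifP => // km.
  have -> : m = k%:Z by lia.
  by rewrite subrr qy; congr (y _ _); lia.
have zw (m : int) : z m 0 = w m.
  have [km|mk] := leP k%:Z m; first by rewrite zy // wy.
  rewrite zq //; last by lia.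
  by rewrite q0; congr w; lia.
have zx (m n : int) : n <= 0 -> m <= 0 -> z m n = x m n.
  move=> n0 m0; have [->|nn0] := eqVneq n 0; first by rewrite zw wx.
  by rewrite /z ifF ?m0 //; lia.
have zr (m n : int) : n <= 0 -> 0 <= m -> z m n = r `|m|%N `|n|%N.
  move=> n0 m0; have [->|nn0] := eqVneq n 0.
    by rewrite zw r0; congr w; lia.
  rewrite /z ifF; last by lia.
  case: ifP => // m0'; have -> : m = 0 by lia.
  by rewrite rx; congr (x _ _); lia.
exists z; split; last first.
- by move=> m n m0 n0; rewrite zy ?addrK //; lia.
- by move=> m n m0 n0; rewrite zx.
- move=> m n; have [n0|n0] := leP 0 n.
    have [km|mk] := leP k%:Z m.
      rewrite !zy; try lia.
      exact: vy.
    rewrite !zq; try lia.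
    have -> : `|(n + 1)%R|%N = `|n|%N.+1 by lia.
    exact: qv.
  have [m0|m0] := leP m 0; first by rewrite !zx //; lia.
  rewrite !zr; try lia.
  have -> : `|n|%N = `|(n + 1)%R|%N.+1 by lia.
  exact: rv.
- move=> m n; have [n0|n0] := leP 0 n.
    have [km|mk] := leP k%:Z m.
      rewrite !zy; try lia.
      have -> : m + 1 - k%:Z = m - k%:Z + 1 by lia.
      exact: hy.
    rewrite !zq; try lia.
    have -> : `|(k%:Z - m)%R|%N = `|(k%:Z - (m + 1))%R|%N.+1 by lia.
    exact: qh.
  have [m0|m0] := ltP m 0; first by rewrite !zx //; lia.
  rewrite !zr; try lia.
  have -> : `|(m + 1)%R|%N = `|m|%N.+1 by lia.
  exact: rh.
Qed.

(** The windows are made to fit into the quadrants kept by [glue_quadrants]: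
    [x] is moved so that the window's upper right corner is the origin, and [y]
    so that its lower left corner is. *)
Lemma glue_windows (x y : int -> int -> T) (N : nat) :
  (forall a b, exists k p, [/\ walk k p, p 0%N = a & p k = b]) ->
  admissible h v x -> admissible h v y ->
  exists2 z, admissible h v z & exists d : int * int, forall m n,
    (`|m| <= N)%N -> (`|n| <= N)%N ->
    z m n = x m n /\ z (m + d.1) (n + d.2) = y m n.
Proof.
move=> conn [hx vx] [hy vy].
have [k [p [hp p0 pk]]] := conn (x N%:Z N%:Z) (y (- N%:Z) (- N%:Z)).
pose x' (m n : int) := x (m + N%:Z) (n + N%:Z).
pose y' (m n : int) := y (m - N%:Z) (n - N%:Z).
have x'_adm : admissible h v x' by split=> m n; rewrite /x' addrAC.
have y'_adm : admissible h v y' by split=> m n; rewrite /y' addrAC.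
have [||z [hz vz] [zx zy]] := glue_quadrants _ _ _ _ x'_adm y'_adm hp.
- by rewrite p0 /x' add0r.
- by rewrite pk /y' sub0r.
exists (fun m n => z (m - N%:Z) (n - N%:Z)).
  by split=> m n; rewrite addrAC.
exists (k%:Z + N%:Z + N%:Z, N%:Z + N%:Z) => m n mN nN /=; split.
  by rewrite zx /x' ?subrK //; lia.
have -> : m + (k%:Z + N%:Z + N%:Z) - N%:Z = m + N%:Z + k%:Z by lia.
have -> : n + (N%:Z + N%:Z) - N%:Z = n + N%:Z by lia.
by rewrite zy /y' ?addrK //; lia.
Qed.

End Gluing.

Arguments admissible {T}.
Arguments walk {T}.

(** * Adjacency matrices *)

Section Adjacency.
Variable A : finType.

Lemma adjmx_rank (e : rel A) (a b : A) :
  adjmx e (enum_rank a) (enum_rank b) = e a b :> nat.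
Proof. by rewrite mxE !enum_rankK. Qed.

Lemma mulmx_nat_neq0 (m n p : nat) (M : 'M[nat]_(m, n)) (N : 'M[nat]_(n, p)) i j :
  (M *m N) i j != 0%N <-> exists2 l, M i l != 0%N & N l j != 0%N.
Proof.
rewrite mxE; split=> [|[l Ml Nl]].
  apply: contra_neqP => nex; apply: big1 => l _; apply/eqP.
  have [/eqP Ml|Ml] := boolP (M i l == 0%N); first by rewrite Ml mul0r.
  have [/eqP ->|Nl] := boolP (N l j == 0%N); first by rewrite mulr0.
  by case: nex; exists l.
rewrite (bigD1 l) //= addn_eq0 negb_and muln_eq0 negb_or.
by rewrite Ml Nl.
Qed.

Lemma adjmx_mul_neq0 (e f : rel A) (a d : A) :
  (adjmx e *m adjmx f) (enum_rank a) (enum_rank d) != 0%N <->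
  exists2 b, e a b & f b d.
Proof.
split=> [/mulmx_nat_neq0[l]|[b eab fbd]].
  by rewrite -(enum_valK l) !adjmx_rank !eqb0 !negbK; exists (enum_val l).
by apply/mulmx_nat_neq0; exists (enum_rank b); rewrite adjmx_rank eqb0 negbK.
Qed.

Lemma irreducible_walk (e : rel A) : irreducible_mx (adjmx e) ->
  forall a b, exists k p, [/\ walk e k p, p 0%N = a & p k = b].
Proof.
move=> irr a b; have [k _ Mk] := irr (enum_rank a) (enum_rank b); exists k.
elim: k a Mk => [|k IH] a.
  rewrite expr0 mxE; have [/enum_rank_inj ab _|_ /eqP []] // := eqVneq (enum_rank a).
  by exists (fun=> a).
rewrite exprS => /mulmx_nat_neq0[l].
rewrite -(enum_valK l) adjmx_rank eqb0 negbK => eal /IH[p [hp p0 pk]].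
exists (fun i => if i is i'.+1 then p i' else a); split=> // -[_|i ik].
  by rewrite p0.
exact: hp.
Qed.

Lemma graph_shiftP (G : graph2d A) (x : config A) :
  graph_shift G x <->
  admissible (hedge G) (vedge G) (fun m n => x (m, n)).
Proof.
split=> [Gx|[hx vx] m n]; last first.
  by rewrite !adjmx_rank hx vx.
by split=> m n; have := Gx m n; rewrite !adjmx_rank => -[];
  [case: hedge|case: vedge].
Qed.

End Adjacency.

(** * Neighbourhoods and finite windows *)

Section Windows.
Variable A : finType.

Lemma nbhs_window (x : config A) (V : set (config A)) : nbhs x V ->
  exists N : nat, forall z : config A,
    (forall m n, (`|m| <= N)%N -> (`|n| <= N)%N -> z (m, n) = x (m, n)) -> V z.
Proof.
(* The sets containing a window cylinder around [x] form a filter; it converges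
   to [x] for the product topology because it does so coordinatewise. *)
pose F : set_system (config A) := fun V => exists N : nat, forall z : config A,
  (forall m n, (`|m| <= N)%N -> (`|n| <= N)%N -> z (m, n) = x (m, n)) -> V z.
have FF : Filter F.
  split; first by exists 0%N.
  - move=> P Q [N1 P1] [N2 Q2]; exists (maxn N1 N2) => z zx; split.
      by apply: P1 => m n ? ?; apply: zx; lia.
    by apply: Q2 => m n ? ?; apply: zx; lia.
  - by move=> P Q PQ [N PN]; exists N => z /PN /PQ.
suff : F --> x by apply.
apply/cvg_sup => -[m n] P; rewrite nbhsE => -[B [[C oC <-] Cx] CP].
exists (maxn `|m|%N `|n|%N) => z zx; apply: CP.
by rewrite /= zx ?leq_maxl ?leq_maxr.
Qed.

(** Windows of any two points in a single point, up to translation, is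
    transitivity expressed on a basis of the topology. *)
Lemma transitive_windows (X : set (config A)) :
  (forall (x y : config A) (N : nat), X x -> X y ->
    exists2 z : config A, X z & exists d : int * int, forall m n,
      (`|m| <= N)%N -> (`|n| <= N)%N ->
      z (m, n) = x (m, n) /\ z (m + d.1, n + d.2) = y (m, n)) ->
  (forall (a : int * int) (x : config A), X x -> X (shift2d a x)) ->
  transitive_shift X.
Proof.
move=> glue shiftX U W UX WX /open_subspaceP[U' oU' UU'] /open_subspaceP[W' oW' WW'].
move=> [x Ux] [y Wy].
have U'x : U' x by have [] : (U' `&` X) x by rewrite UU'; split=> //; exact: UX.
have W'y : W' y by have [] : (W' `&` X) y by rewrite WW'; split=> //; exact: WX.
have [N1 HU] := nbhs_window _ _ (open_nbhs_nbhs (conj oU' U'x)).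
have [N2 HW] := nbhs_window _ _ (open_nbhs_nbhs (conj oW' W'y)).
have [z Xz [d zd]] := glue x y (maxn N1 N2) (UX _ Ux) (WX _ Wy).
exists d, (shift2d d z); split.
  exists z => //.
  have [] // : (U `&` X) z.
  rewrite -UU'; split=> //; apply: HU => m n ? ?.
  by apply: (zd _ _ _ _).1; lia.
have [] // : (W `&` X) (shift2d d z).
rewrite -WW'; split; last exact: shiftX.
apply: HW => m n mN nN; have [||_ zdy] := zd m n; [lia|lia|exact: zdy].
Qed.

End Windows.

(** * Transitivity *)

Theorem proposition2 (A : finType) (G : graph2d A)
    (XG_shift_space : shift_space (graph_shift G))
    (HV_VH : forall i j : 'I_#|A|,
       (hadj G *m vadj G) i j != 0%N <-> (vadj G *m hadj G) i j != 0%N)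
    (irr : irreducible_mx (hadj G) \/ irreducible_mx (vadj G)) :
  transitive_shift (graph_shift G).
Proof.
have hv_vh a d : (exists2 b, hedge G a b & vedge G b d) <->
    (exists2 c, vedge G a c & hedge G c d).
  split=> /adjmx_mul_neq0 /HV_VH.
    by move/adjmx_mul_neq0.
  by move/adjmx_mul_neq0.
case: XG_shift_space => _ _ shiftG.
apply: transitive_windows => [x y N|a x Gx]; last first.
  by rewrite -(shiftG a); exists x.
move=> /graph_shiftP Gx /graph_shiftP Gy.
case: irr => /irreducible_walk conn.
  have [z Gz [d zd]] := glue_windows _ _ _ hv_vh _ _ N conn Gx Gy.
  by exists (fun k => z k.1 k.2); [exact/graph_shiftP | exists d].
(* Exchanging the coordinates turns vertical paths into horizontal ones. *)
have vh_hv a d : (exists2 b, vedge G a b & hedge G b d) <->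
    (exists2 c, hedge G a c & vedge G c d) by apply: iff_sym.
have [||z [vz hz] [d zd]] := glue_windows _ _ _ vh_hv
  (fun m n => x (n, m)) (fun m n => y (n, m)) N conn.
- by split=> m n; [exact: Gx.2 | exact: Gx.1].
- by split=> m n; [exact: Gy.2 | exact: Gy.1].
exists (fun k => z k.2 k.1); first by apply/graph_shiftP; split=> m n.
by exists (d.2, d.1) => m n mN nN; exact: zd.
Qed.
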